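(* A graph $G$ is a CI$\mathcal{O}$ graph if and only if every block $B$ of $G$ is a CI$\mathcal{O}$ graph.
   Context: All graphs are finite and simple; $k$ is a field. A block is a maximal connected subgraph without a cut vertex (of itself); thus blocks may be isolated vertices, bridges, or maximal $2$-connected subgraphs. Given a graph $G$ with vertices $x_1,\dots,x_n$, $q$ edges and $r$ connected components, and an orientation $\mathcal{O}$ of its edges, $D=G_{\mathcal{O}}$ is the resulting oriented graph, with edges $t_1,\dots,t_q$. The toric ideal $P_D$ is the kernel of the $k$-algebra map $\varphi:k[t_1,\dots,t_q]\to k[x_1^{\pm1},\dots,x_n^{\pm1}]$ sending an edge $t_\ell=(x_i,x_j)$ (from $x_i$ to $x_j$) to $x_jx_i^{-1}$. It has height $q-n+r$. $P_D$ is a binomial complete intersection if it can be generated by $q-n+r$ binomials (polynomials of the form $t^\alpha-t^\beta$). $G$ is a CI$\mathcal{O}$ graph if $P_{G_{\mathcal{O}}}$ is a binomial complete intersection for every orientation $\mathcal{O}$ of $G$. *)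

(* Defs.v *)
From HB Require Import structures.
From mathcomp Require Import all_boot all_order all_algebra.
From mathcomp Require Import mpoly.

Set Implicit Arguments.
Unset Strict Implicit.
Unset Printing Implicit Defensive.

Import GRing.Theory.
Local Open Scope ring_scope.

Record sgraph := SGraph {
  vertex :> finType;
  adj : rel vertex;
  adj_sym : ssrbool.symmetric adj;
  adj_irr : irreflexive adj }.

Arguments adj : clear implicits.

Definition connected (G : sgraph) : Prop :=
  (0 < #|G|)%N /\ forall x y : G, connect (adj G) x y.

(* v separates two other vertices lying in the same connected component. *)
Definition cut_vertex (G : sgraph) (v : G) : Prop :=
  exists x y : G,
    [/\ x != v, y != v, connect (adj G) x y
      & ~~ connect [rel a b | [&& a != v, b != v & adj G a b]] x y].

(* Subgraphs need not be induced. *)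
Record subgraph (G : sgraph) := Subgraph {
  sverts : {set G};
  sadj : rel G;
  sadj_sym : ssrbool.symmetric sadj;
  sadj_sub : forall x y,
    sadj x y -> [&& x \in sverts, y \in sverts & adj G x y] }.

Definition subgraph_le (G : sgraph) (B C : subgraph G) : Prop :=
  sverts B \subset sverts C /\ subrel (sadj B) (sadj C).

Definition sub_adj (G : sgraph) (B : subgraph G) :
    rel {x : G | x \in sverts B} :=
  [rel x y | sadj B (val x) (val y)].

Lemma sub_adj_sym (G : sgraph) (B : subgraph G) : ssrbool.symmetric (@sub_adj G B).
Proof. by move=> x y; rewrite /sub_adj /= sadj_sym. Qed.

Lemma sub_adj_irr (G : sgraph) (B : subgraph G) : irreflexive (@sub_adj G B).
Proof.
by move=> x; apply/negP => /= /sadj_sub /and3P[_ _]; rewrite adj_irr.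
Qed.

Definition sgraph_of_subgraph (G : sgraph) (B : subgraph G) : sgraph :=
  SGraph (@sub_adj_sym G B) (@sub_adj_irr G B).

Coercion sgraph_of_subgraph : subgraph >-> sgraph.

Definition connected_no_cut_vertex (G : sgraph) : Prop :=
  connected G /\ ~ exists v : G, cut_vertex v.

Definition is_block (G : sgraph) (B : subgraph G) : Prop :=
  connected_no_cut_vertex B /\
  forall C : subgraph G,
    connected_no_cut_vertex C -> subgraph_le B C -> subgraph_le C B.

(* o x y means that the edge {x, y} is oriented from x to y. *)
Definition orientation (G : sgraph) (o : rel G) : Prop :=
  (forall x y, adj G x y = o x y || o y x) /\
  (forall x y, ~~ (o x y && o y x)).

Definition arcs (G : sgraph) (o : rel G) : {set G * G} :=
  [set p | o p.1 p.2].

(* The Laurent polynomial ring k[x_1^{+-1}, ..., x_n^{+-1}] is regarded as a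
   subring of the field of fractions of k[x_1, ..., x_n]; the variables t_l
   and x_i are indexed by the enumerations of the arcs and of the vertices. *)
Definition toric_map (k : fieldType) (G : sgraph) (o : rel G)
    (f : {mpoly k[#|arcs o|]}) : {fraction {mpoly k[#|G|]}} :=
  mmap (fun c : k => tofrac (c%:MP_[#|G|]))
    (fun l : 'I_#|arcs o| =>
       tofrac 'X_(enum_rank (enum_val l).2) /
       tofrac 'X_(enum_rank (enum_val l).1))
    f.

Definition toric_ideal (k : fieldType) (G : sgraph) (o : rel G)
    (f : {mpoly k[#|arcs o|]}) : Prop :=
  toric_map f = 0.

Definition generated_ideal (R : comNzRingType) (m : nat) (g : 'I_m -> R)
    (f : R) : Prop :=
  exists c : 'I_m -> R, f = \sum_(i < m) c i * g i.

Definition is_binomial (k : fieldType) (q : nat) (f : {mpoly k[q]}) : Prop :=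
  exists a b : 'X_{1..q}, f = 'X_[a] - 'X_[b].

Definition nb_components (G : sgraph) : nat := n_comp (adj G) predT.

(* q - n + r, written so that truncated subtraction is harmless:
   n <= q + r holds in every graph. *)
Definition toric_height (G : sgraph) (o : rel G) : nat :=
  (#|arcs o| + nb_components G - #|G|)%N.

Definition binomial_complete_intersection (k : fieldType) (G : sgraph)
    (o : rel G) : Prop :=
  exists g : 'I_(toric_height o) -> {mpoly k[#|arcs o|]},
    (forall i, is_binomial (g i)) /\
    (forall f, toric_ideal f <-> generated_ideal g f).

Definition CIO (k : fieldType) (G : sgraph) : Prop :=
  forall o : rel G, orientation o -> binomial_complete_intersection k o.

(* Main.v *)
Require Import Defs.
From mathcomp Require Import all_boot all_order all_algebra.
From mathcomp Require Import mpoly ssrcomplements zify lra.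
From HB Require Import structures.
From Stdlib Require Import Classical ClassicalEpsilon.

(** Two monomials have the same image in the Laurent polynomial ring exactly
    when their exponents, viewed as flows on the arcs, have the same net flow at
    every vertex ("balanced"). A toric ideal is generated by binomials
    [t^a_i - t^b_i] iff the pairs [(a_i, b_i)] generate the congruence of
    balanced flows, so being a complete intersection says that this congruence
    is generated by as many pairs as the dimension of the rational cycle space.

    A block [B] splits flows: the restriction of a balanced pair to the arcs of
    [B] is balanced. Hence generators for the blocks together generate the
    congruence of [G], and the cycle dimensions add up. Conversely, orient the
    edges outside [B] along a linear order of the vertices, so that they carry
    no closed flow. Then a chain of moves between flows supported on [B] uses
    only generators supported on [B], and the other generators must be
    sufficiently many, since they span the image of the cycle space outside
    [B]. *)

Set Implicit Arguments.
Unset Strict Implicit.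
Unset Printing Implicit Defensive.

Import GRing.Theory.
Local Open Scope ring_scope.

(** * Binomial ideals and congruences *)

(** The least congruence containing [s], presented by elementary moves. The operation is a parameter
    because the same notion serves monomial exponents and flows. *)
Inductive cong (M : eqType) (add : M -> M -> M) (s : seq (M * M)) :
    M -> M -> Prop :=
  | cong_refl a : cong add s a a
  | cong_gen a b c : (a, b) \in s -> cong add s (add a c) (add b c)
  | cong_sym a b : cong add s a b -> cong add s b a
  | cong_trans a b c : cong add s a b -> cong add s b c -> cong add s a c.

Section Laurent.

Variables (k : fieldType) (q n : nat) (h t : 'I_q -> 'I_n).

(** The exponent of the image of ['X_[m]] under the substitution of ['X_(e l)] for the [l]-th
    variable. *)
Definition mnm_push (e : 'I_q -> 'I_n) (m : 'X_{1..q}) : 'X_{1..n} :=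
  (\sum_(l < q) U_(e l) *+ m l)%MM.

Lemma mnm_pushE e m i : mnm_push e m i = (\sum_(l < q | e l == i) m l)%N.
Proof.
rewrite /mnm_push mnm_sumE [RHS]big_mkcond; apply: eq_bigr => l _.
by rewrite mulmnE mnm1E; case: eqP => _; rewrite ?mul1n ?mul0n.
Qed.

(** Equality of the two Laurent monomials with denominators cleared, so that all exponents stay
    natural numbers. *)
Definition mnm_bal (a b : 'X_{1..q}) : Prop :=
  (mnm_push h a + mnm_push t b = mnm_push h b + mnm_push t a)%MM.


Definition laurent (f : {mpoly k[q]}) : {fraction {mpoly k[n]}} :=
  mmap (fun c : k => tofrac (c%:MP_[n]))
    (fun l => tofrac 'X_(h l) / tofrac 'X_(t l)) f.

(** Packaging the coefficient map as a ring morphism makes the morphism properties of [mmap]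
    available; [laurentE] then holds by conversion. *)
Let const_frac : {rmorphism k -> {fraction {mpoly k[n]}}} :=
  @tofrac {mpoly k[n]} \o @mpolyC n k.

Let laurent_rmorph : {rmorphism {mpoly k[q]} -> {fraction {mpoly k[n]}}} :=
  mmap const_frac (fun l => tofrac 'X_(h l) / tofrac 'X_(t l)).

Let laurentE f : laurent f = laurent_rmorph f.
Proof. by []. Qed.

Lemma laurentX m :
  laurent 'X_[m] =
  tofrac 'X_[mnm_push h m] / tofrac 'X_[mnm_push t m].
Proof.
rewrite /laurent (@mmapX _ _ _ _ const_frac).
rewrite /mmap1 /mnm_push -!mprodXnE !rmorph_prod -prodf_div.
by apply: eq_bigr => l _; rewrite expr_div_n !rmorphXn.
Qed.


Let mpolyX_inj (r : nat) (a b : 'X_{1..r}) : 'X_[k, a] = 'X_[b] -> a = b.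
Proof.
move=> /(congr1 (mcoeff a)); rewrite !mcoeffX eqxx.
by case: eqP => [->//|_] /eqP; rewrite oner_eq0.
Qed.

Let tofracX_neq0 m : tofrac ('X_[m] : {mpoly k[n]}) != 0.
Proof.
rewrite tofrac_eq0; apply/eqP => /(congr1 (mcoeff m)).
by rewrite mcoeffX eqxx mcoeff0 => /eqP; rewrite oner_eq0.
Qed.

Lemma laurentX_eq a b : laurent 'X_[a] = laurent 'X_[b] <-> mnm_bal a b.
Proof.
rewrite !laurentX /mnm_bal.
split=> [/eqP|E].
  rewrite eqr_div ?tofracX_neq0 // -!rmorphM -!mpolyXD /=.
  by rewrite tofrac_eq => /eqP /mpolyX_inj.
by apply/eqP; rewrite eqr_div ?tofracX_neq0 // -!rmorphM -!mpolyXD /= E.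
Qed.

(** Multiplication by ['X_[N]], a common multiple of all denominators, gives an identity of
    polynomials. The monomials of [f] with the same Laurent image as [m0] all land on one monomial,
    whose coefficient must vanish. *)
Lemma laurent_eq0_sum f m0 : laurent f = 0 -> m0 \in msupp f ->
  \sum_(m <- msupp f | (mnm_push h m + mnm_push t m0 ==
                        mnm_push h m0 + mnm_push t m)%MM) f@_m = 0.
Proof.
move=> f0 m0f; pose N := (\sum_(m <- msupp f) mnm_push t m)%MM.
have leN m : m \in msupp f -> (mnm_push t m <= N)%MM.
  move=> mf; rewrite /N (big_rem _ mf) /=; exact: lem_addr.
have : tofrac 'X_[N] * laurent f = 
    tofrac (\sum_(m <- msupp f) f@_m *: 'X_[N - mnm_push t m + mnm_push h m]).
  rewrite {1}[f]mpolyE laurentE !rmorph_sum mulr_sumr big_seq [RHS]big_seq.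
  apply: eq_bigr => m /leN le_m.
  rewrite -mul_mpolyC rmorphM -!laurentE laurentX -mul_mpolyC.
  rewrite {1}/laurent (@mmapC _ _ _ _ const_frac) /=.
  rewrite rmorphM mulrCA; congr (_ * _).
  rewrite -{1}(submK le_m) !mpolyXD !rmorphM /=.
  by rewrite -mulrA [X in _ * X]mulrCA mulfV ?tofracX_neq0 // mulr1.
rewrite f0 mulr0 => /esym/eqP; rewrite tofrac_eq0 => /eqP.
move/(congr1 (mcoeff (N - mnm_push t m0 + mnm_push h m0)%MM)).
rewrite mcoeff0 raddf_sum /= => sum0; rewrite -[RHS]sum0.
rewrite [LHS]big_mkcond; apply: eq_big_seq => m mf.
rewrite mcoeffZ mcoeffX.
(* Subtraction of exponents is truncated; the bounds [leN] make the cancellation of [N]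
   legitimate. *)
have -> : (N - mnm_push t m + mnm_push h m ==
           N - mnm_push t m0 + mnm_push h m0)%MM =
          (mnm_push h m + mnm_push t m0 == mnm_push h m0 + mnm_push t m)%MM.
  apply/eqP/eqP => /mnmP E; apply/mnmP => i; have := E i;
  have /mnm_lepP/(_ i) := leN _ mf; have /mnm_lepP/(_ i) := leN _ m0f;
  rewrite !(mnmDE, mnmBE); move: (N i) (mnm_push _ _ _) (mnm_push _ _ _)
   (mnm_push _ _ _) (mnm_push _ _ _) => *; lia.
by case: eqP; rewrite ?mulr1 ?mulr0.
Qed.

Section Ideal.

Variables (d : nat) (u v : 'I_d -> 'X_{1..q}).

Let s := [seq (u i, v i) | i : 'I_d].
Let I (f : {mpoly k[q]}) := generated_ideal (fun i => 'X_[u i] - 'X_[v i]) f.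

Let ideal0 : I 0.
Proof. by exists (fun _ => 0); rewrite big1 // => i _; rewrite mul0r. Qed.

Let idealD f g : I f -> I g -> I (f + g).
Proof.
move=> [c ->] [e ->]; exists (fun i => c i + e i); rewrite -big_split.
by apply: eq_bigr => i _; rewrite mulrDl.
Qed.

Let idealM f g : I g -> I (f * g).
Proof.
move=> [c ->]; exists (fun i => f * c i); rewrite mulr_sumr.
by apply: eq_bigr => i _; rewrite mulrA.
Qed.

Let ideal_cong a b : cong mnm_add s a b -> I ('X_[a] - 'X_[b]).
Proof.
elim=> [{}a|{}a {}b c|{}a {}b _ H|{}a {}b c _ H1 _ H2].
- by rewrite subrr.
- move=> /mapP[i _ [-> ->]]; rewrite !mpolyXD -mulrBl mulrC; apply: idealM.
  exists (fun j => (i == j)%:R); rewrite (bigD1 i) //= eqxx mul1r big1 ?addr0 //.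
  by move=> j /negPf ij; rewrite eq_sym ij mul0r.
- by rewrite -opprB -mulN1r; apply: idealM.
- by rewrite -(subrKA ('X_[b])); apply: idealD.
Qed.

(* The linear functional that sums the coefficients of the monomials
   congruent to [a] vanishes on the ideal. *)
Let ideal_separated a b : I ('X_[a] - 'X_[b]) -> cong mnm_add s a b.
Proof.
move=> [c E]; apply: NNPP => nab.
(* Excluded middle turns the congruence class of [a] into a boolean indicator, which can serve as a
   coefficient. *)
have [chi chiP] : exists chi : 'X_{1..q} -> bool,
    forall m, chi m <-> cong mnm_add s a m.
  exists (fun m =>
    if excluded_middle_informative (cong mnm_add s a m) then true else false).
  by move=> m; case: excluded_middle_informative.
pose L (f : {mpoly k[q]}) : k := \sum_(m <- msupp f) f@_m * (chi m)%:R.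
(* Supports vary with the polynomial; over a common range of monomials additivity becomes
   termwise. *)
have LE f w : (msize f <= w)%N -> L f = \sum_(m : 'X_{1..q < w}) f@_m * (chi m)%:R.
  move=> le_fw; rewrite /L (big_mksub ('X_{1..q < w})) ?msupp_uniq //=; last first.
    by move=> m /msize_mdeg_lt /leq_trans; apply.
  by rewrite big_rmcond //= => m /memN_msupp_eq0 ->; rewrite mul0r.
have LD f g : L (f + g) = L f + L g.
  pose w := (msize (f + g) + (msize f + msize g))%N.
  rewrite !(LE _ w) /w; try lia.
  by rewrite -big_split; apply: eq_bigr => m _; rewrite mcoeffD mulrDl.
have L0 : L 0 = 0 by rewrite /L msupp0 big_nil.
have LZX x m : L (x *: 'X_[m]) = x * (chi m)%:R.
  have [->|x0] := eqVneq x 0; first by rewrite scale0r L0 mul0r.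
  rewrite /L (perm_big [:: m]) ?big_seq1 ?mcoeffZ ?mcoeffX ?eqxx ?mulr1 //.
  by apply: (perm_trans (msuppZ _ x0)); rewrite msuppX.
have Lsum (J : Type) (r : seq J) F : L (\sum_(j <- r) F j) = \sum_(j <- r) L (F j).
  exact: (big_morph L LD L0).
have LN f : L (- f) = - L f.
  by apply/eqP; rewrite -addr_eq0 -LD addNr L0.
have Lgen f i : L (f * ('X_[u i] - 'X_[v i])) = 0.
  rewrite [f]mpolyE mulr_suml Lsum big1 // => m _.
  rewrite mulrBr -!scalerAl -!mpolyXD LD LN !LZX -mulrBr.
  suff -> : chi (m + u i)%MM = chi (m + v i)%MM by rewrite subrr mulr0.
  have c_uv : cong mnm_add s (m + u i)%MM (m + v i)%MM.
    rewrite addmC [X in cong _ _ _ X]addmC; apply: cong_gen.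
    exact: map_f (mem_enum _ _).
  apply/idP/idP => /chiP H; apply/chiP; apply: cong_trans H _ => //.
  exact: cong_sym.
have : L ('X_[a] - 'X_[b]) = 0 by rewrite E Lsum big1.
rewrite LD LN -['X_[a]]scale1r -['X_[b]]scale1r !LZX.
have -> : chi a by apply/chiP; exact: cong_refl.
have /negPf-> : ~~ chi b by apply/negP => /chiP.
by move/eqP; rewrite !mul1r subr0 oner_eq0.
Qed.

(** Induction on the size of the support. By [laurent_eq0_sum] a monomial [m0] of [f] cannot be
    alone in its class. Subtracting a multiple of the binomial formed with another monomial [m1] of
    [f] removes [m0] and introduces no new monomial. *)
Let ideal_laurent_eq0 f :
  (forall a b, mnm_bal a b -> I ('X_[a] - 'X_[b])) -> laurent f = 0 -> I f.
Proof.
move=> Ibal; have [w] := ubnP (size (msupp f)); elim: w f => // w IHw f le_fw f0.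
case E : (msupp f) => [|m0 r].
  by have /eqP := E; rewrite msupp_eq0 => /eqP ->; exact: ideal0.
have m0f : m0 \in msupp f by rewrite E mem_head.
have [m1 [m1f m10 bal]] : exists m1, [/\ m1 \in msupp f, m1 != m0 & mnm_bal m1 m0].
  apply: NNPP => none; have := laurent_eq0_sum f0 m0f.
  rewrite big_mkcond (bigD1_seq m0) ?msupp_uniq //= eqxx.
  rewrite big_seq_cond big1 => [|m /andP[mf m0m]].
    by move/eqP; rewrite addr0 mcoeff_eq0 m0f.
  by case: eqP => // bal; case: none; exists m.
have f1 : laurent ('X_[m0] - 'X_[m1]) = 0.
  by rewrite laurentE rmorphB -!laurentE; apply/eqP; rewrite subr_eq0;
     apply/eqP/laurentX_eq.
pose g := f - f@_m0 *: ('X_[m0] - 'X_[m1]).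
have -> : f = g + (f@_m0)%:MP * ('X_[m0] - 'X_[m1]) by rewrite mul_mpolyC subrK.
apply: idealD; last by apply/idealM/Ibal.
apply: IHw; last first.
  by rewrite /g laurentE rmorphB -mul_mpolyC rmorphM -!laurentE f0 f1 mulr0 subrr.
rewrite -ltnS; apply: leq_trans le_fw; rewrite ltnS.
have sub : {subset msupp g <= rem m0 (msupp f)}.
  move=> m; rewrite mem_rem_uniq ?msupp_uniq // !inE !mcoeff_msupp /g.
  rewrite mcoeffB mcoeffZ mcoeffB !mcoeffX.
  have [<-|m0m] := eqVneq m0 m; first by rewrite (negPf m10) subr0 mulr1 subrr eqxx.
  have [<-|m1m] := eqVneq m1 m; first by rewrite -[f@_m1 != 0]mcoeff_msupp m1f.
  by rewrite subrr mulr0 subr0.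
have := uniq_leq_size (msupp_uniq g) sub.
by rewrite size_rem // E.
Qed.

(** This replaces ideals by congruences: the kernel is generated by balanced binomials, and a
    binomial lies in [I] exactly when its exponents are congruent. The right-hand side no longer
    mentions the field. *)
Lemma laurent_kernel_generated :
  (forall f, laurent f = 0 <-> I f) <->
  (forall i, mnm_bal (u i) (v i)) /\
  (forall a b, mnm_bal a b -> cong mnm_add s a b).
Proof.
have kerX a b : laurent ('X_[a] - 'X_[b]) = 0 <-> mnm_bal a b.
  rewrite laurentE rmorphB -!laurentE -laurentX_eq.
  by split=> [/eqP|->]; rewrite ?subrr // subr_eq0 => /eqP.
split=> [ker|[bal_uv bal_cong] f].
  split=> [i|a b /kerX /ker]; last exact: ideal_separated.
  by apply/kerX/ker; apply: ideal_cong; rewrite -[u i]addm0 -[v i]addm0;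
     apply: cong_gen; apply: map_f (mem_enum _ _).
split=> [|[c ->]]; first by apply: ideal_laurent_eq0 => a b /bal_cong /ideal_cong.
rewrite laurentE rmorph_sum big1 // => i _.
by have /kerX := bal_uv i; rewrite rmorphM -!laurentE => ->; rewrite mulr0.
Qed.

End Ideal.

End Laurent.

(** * The rational cycle space *)

Notation rfun T := {ffun T -> rat^o}.

Section Supported.

Variable T : finType.
Implicit Types (A : {set T}) (c : rfun T).

(** The linear map that erases the entries in [A]. Its kernel is taken as [supported A], and
    rank-nullity for it compares the cycle spaces of nested arc sets. *)
Definition off A c : rfun T := [ffun x => if x \in A then 0 else c x].

Fact off_linear A : linear (off A).
Proof.
move=> z c e; apply/ffunP=> x; rewrite !ffunE.
by case: ifP; rewrite ?scaler0 ?addr0.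
Qed.

HB.instance Definition _ A :=
  GRing.isLinear.Build rat (rfun T) (rfun T) _ (off A) (off_linear A).

Definition supported A : {vspace rfun T} := lker (linfun (off A)).

Lemma supportedP A c :
  reflect (forall x, x \notin A -> c x = 0) (c \in supported A).
Proof.
rewrite memv_ker lfunE /=; apply: (iffP eqP) => [/ffunP c0 x xA|c0].
  by have := c0 x; rewrite !ffunE (negPf xA).
by apply/ffunP=> x; rewrite !ffunE; case: ifPn => // /c0.
Qed.

Definition delta (x : T) : rfun T := [ffun y => (x == y)%:R].

Lemma rfun_sum_delta c : c = \sum_x c x *: delta x.
Proof.
apply/ffunP=> y; rewrite sum_ffunE (bigD1 y) //= !ffunE eqxx.
rewrite big1 ?addr0 => [|x /negPf xy].
  by rewrite /GRing.scale /= mulr1.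
by rewrite !ffunE xy scaler0.
Qed.

(** The delta functions bound the dimensions for [A] and for its complement from above; the two
    subspaces together span everything, so both bounds are attained. *)
Lemma dim_supported A : \dim (supported A) = #|A|.
Proof.
have le_dim B : (\dim (supported B) <= #|B|)%N.
  rewrite -[X in (_ <= X)%N](size_image delta) (leq_trans _ (dim_span _)) //.
  apply: dimvS; apply/subvP => c /supportedP c0.
  rewrite (rfun_sum_delta c) memv_suml // => x _.
  have [xB|/c0->] := boolP (x \in B); last by rewrite scale0r mem0v.
  by apply/memvZ/memv_span; exact: image_f.
apply/eqP; rewrite eqn_leq le_dim /=.
have := le_dim (~: A); have := cardsC A.
suff : (#|T| <= \dim (supported A) + \dim (supported (~: A)))%N by lia.
have -> : #|T| = \dim (fullv : {vspace rfun T}) by rewrite dimvf /= /dim /= muln1.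
rewrite -dimv_sum_cap (leq_trans _ (leq_addr _ _)) //; apply: dimvS.
apply/subvP => c _; have -> : c = off (~: A) c + off A c.
  by apply/ffunP=> x; rewrite !ffunE inE; case: (x \in A); rewrite ?addr0 ?add0r.
apply: memv_add; apply/supportedP => x; rewrite !ffunE inE; first by move->.
by rewrite negbK => ->.
Qed.

End Supported.

Section Boundary.

Variable V : finType.
Implicit Types (E F : {set V * V}) (c : rfun (V * V)%type).

(** The boundary map is defined on functions of all ordered pairs. Arc sets enter only through
    supports, so their cycle spaces lie in one ambient space. *)
Definition bdry c : rfun V :=
  [ffun v => \sum_(p | p.2 == v) c p - \sum_(p | p.1 == v) c p].

Fact bdry_linear : linear bdry.
Proof.
move=> z c e; apply/ffunP=> v.
rewrite !ffunE scalerBr !scaler_sumr addrACA -opprD -!big_split.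
by congr (_ - _); apply: eq_bigr => p _; rewrite !ffunE.
Qed.

HB.instance Definition _ :=
  GRing.isLinear.Build rat (rfun (V * V)%type) (rfun V) _ bdry bdry_linear.

Definition cycles E : {vspace rfun (V * V)%type} :=
  (supported E :&: lker (linfun bdry))%VS.

Lemma cyclesP E c :
  reflect ((forall p, p \notin E -> c p = 0) /\ bdry c = 0) (c \in cycles E).
Proof.
rewrite memv_cap memv_ker lfunE /=; apply: (iffP andP).
  by move=> [/supportedP c0 /eqP].
by move=> [c0 ->]; split=> //; apply/supportedP.
Qed.

Lemma bdry_delta p : bdry (delta p) = delta p.2 - delta p.1.
Proof.
have sumE (Q : pred (V * V)) : \sum_(p' | Q p') (delta p : rfun _) p' = (Q p)%:R.
  rewrite big_mkcond (bigD1 p) //= ffunE eqxx big1 ?addr0 => [|p' pp'].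
    by case: (Q p).
  by rewrite ffunE eq_sym (negPf pp') if_same.
by apply/ffunP=> v; rewrite !ffunE !sumE.
Qed.

(** Cycles on disjoint arc sets are linearly independent. Equality may fail, since a cycle can use
    arcs from both sets. *)
Lemma dim_cyclesU E E' : [disjoint E & E'] ->
  (\dim (cycles E) + \dim (cycles E') <= \dim (cycles (E :|: E')))%N.
Proof.
move=> dis; rewrite -dimv_disjoint_sum.
  apply: dimvS; rewrite subv_add; apply/andP; split; apply/subvP=> c /cyclesP[c0 cb];
  by apply/cyclesP; split=> // p; rewrite inE negb_or => /andP[p1 p2]; apply: c0.
apply/eqP; rewrite -subv0; apply/subvP=> c.
rewrite memv_cap => /andP[/cyclesP[c1 _] /cyclesP[c2 _]].
rewrite memv0; apply/eqP/ffunP=> p; rewrite !ffunE.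
have [pE|] := boolP (p \in E); last exact: c1.
by apply: c2; rewrite (disjointFr dis).
Qed.

(** Rank-nullity for [off F] on [cycles E]: the kernel consists of the cycles supported on [F]. *)
Lemma dim_cycles_off E F : F \subset E ->
  \dim (cycles E) = (\dim (cycles F) + \dim (linfun (off F) @: cycles E))%N.
Proof.
move=> FE; rewrite -(limg_ker_dim (linfun (off F)) (cycles E)); congr (\dim _ + _)%N.
apply/vspaceP=> c; rewrite memv_cap -/(supported F); apply/andP/idP.
  by move=> [/cyclesP[_ cb] /supportedP c0]; apply/cyclesP.
move=> /cyclesP[c0 cb]; split; last exact/supportedP.
by apply/cyclesP; split=> // p pE; apply: c0; apply: contraNN pE => /(subsetP FE).
Qed.

End Boundary.

(** * The dimension of the cycle space of a graph *)

Section CycleDim.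

Variables (G : sgraph) (o : rel G) (V : finType) (f : G -> V).
Hypotheses (oG : orientation o) (f_inj : injective f).

(** Arcs are moved into an ambient vertex type [V], so that a graph and its blocks yield arc sets of
    the same type. *)
Definition pair_map (p : G * G) : V * V := (f p.1, f p.2).

Lemma pair_map_inj : injective pair_map.
Proof. by move=> [a b] [c d] [/f_inj-> /f_inj->]. Qed.

Let E := pair_map @: arcs o.
Let im := (linfun (@bdry V) @: supported E)%VS.
Let conG := sym_connect_sym (@adj_sym G).

Let arc_im x y : o x y -> delta (f y) - delta (f x) \in im.
Proof.
move=> oxy; rewrite -(bdry_delta (f x, f y)).
rewrite -[bdry _]lfunE; apply: memv_img.
apply/supportedP=> p pE; rewrite ffunE; case: eqP => // Ep; case/negP: pE.
by rewrite -Ep; apply/imsetP; exists (x, y); rewrite ?inE.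
Qed.

Let connect_im x y : connect (adj G) x y -> delta (f y) - delta (f x) \in im.
Proof.
case/connectP=> p; elim: p x => /= [x _ ->|z p IHp x /andP[xz zp] yp].
  by rewrite subrr mem0v.
rewrite -(subrKA (delta (f z))) memvD ?IHp //.
move: xz; rewrite (proj1 oG) => /orP[|/arc_im]; first exact: arc_im.
by rewrite -memvN opprB.
Qed.

(** Sums over connected components, each recorded at the canonical root of its component. *)
Definition comp_sum (c : rfun V) : rfun G :=
  [ffun r => \sum_(x | (fingraph.root (adj G) x == r)) c (f x)].

Fact comp_sum_linear : linear comp_sum.
Proof.
move=> z c e; apply/ffunP=> v; rewrite !ffunE scaler_sumr -big_split.
by apply: eq_bigr => p _; rewrite !ffunE.
Qed.

HB.instance Definition _ :=
  GRing.isLinear.Build rat (rfun V) (rfun G) _ comp_sum comp_sum_linear.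

Let comp_sum_delta x : comp_sum (delta (f x)) = delta (fingraph.root (adj G) x).
Proof.
apply/ffunP=> r; rewrite !ffunE; have [<-|xr] := eqVneq.
  rewrite (bigD1 x) //= ffunE eqxx big1 ?addr0 // => y /andP[_ yx].
  by rewrite ffunE (inj_eq f_inj) eq_sym (negPf yx).
rewrite big1 // => y /eqP yr; rewrite ffunE (inj_eq f_inj); case: eqP => // xy.
by rewrite xy yr eqxx in xr.
Qed.

(** Both ends of an arc lie in one component, so boundaries have zero sum on each component.
    Conversely, a function with zero sums is a combination of differences between a vertex and its
    root, and such a difference telescopes along a path. *)
Let im_eq : im = (supported [set f x | x : G] :&: lker (linfun comp_sum))%VS.
Proof.
apply/vspaceP=> c; apply/idP/idP.
  move: c; apply/subvP.
  rewrite /im; apply/subvP=> _ /memv_imgP[c /supportedP cE ->]; rewrite lfunE /=.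
  rewrite (rfun_sum_delta c) linear_sum memv_suml // => p _.
  rewrite linearZ /=; have [pE|/cE->] := boolP (p \in E); last by rewrite scale0r mem0v.
  apply: memvZ; case/imsetP: pE => -[x y]; rewrite inE /= => oxy ->.
  rewrite bdry_delta /= memv_cap; apply/andP; split.
    apply/supportedP=> v vf; rewrite !ffunE.
    by do 2!(case: eqP => [vE|_]; first by rewrite -vE imset_f in vf); rewrite subrr.
  rewrite memv_ker lfunE /= linearB /= !comp_sum_delta subr_eq0; apply/eqP; congr delta.
  by apply/eqP; rewrite (root_connect conG) connect1 // adj_sym (proj1 oG) oxy.
rewrite memv_cap memv_ker lfunE /= => /andP[/supportedP cf /eqP c0].
(* The added root terms cancel, because the coefficients sum to zero over each component. *)
have -> : c = \sum_x c (f x) *: (delta (f x) - delta (f (fingraph.root (adj G) x))).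
  transitivity (\sum_x c (f x) *: delta (f x)); last first.
    apply/eqP; rewrite -subr_eq0 -sumrB.
    under eq_bigr do rewrite -scalerBr opprB addrC subrK.
    rewrite (partition_big (fingraph.root (adj G)) predT) //= big1 // => r _.
    under eq_bigr => x /eqP-> do [].
    by rewrite -scaler_suml; have /ffunP/(_ r) := c0; rewrite !ffunE => ->; rewrite scale0r.
  rewrite {1}(rfun_sum_delta c) (bigID (mem [set f x | x : G])) /=.
  rewrite [X in _ + X]big1 => [|v /cf->]; last by rewrite scale0r.
  by rewrite addr0 big_imset //= => x y _ _ /f_inj.
rewrite memv_suml // => x _; apply/memvZ/connect_im.
by rewrite (conG) connect_root.
Qed.

(** Rank-nullity is used twice: [comp_sum] shows that the boundaries have dimension [n - r], and
    [bdry] then leaves [q - (n - r)] for the cycles. *)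
Lemma dim_cycles : \dim (cycles E) = toric_height o.
Proof.
have := limg_ker_dim (linfun (@bdry V)) (supported E).
rewrite -/(cycles E) -/im im_eq dim_supported card_imset; last exact: pair_map_inj.
have := limg_ker_dim (linfun comp_sum) (supported [set f x | x : G]).
have -> : (linfun comp_sum @: supported [set f x | x : G])%VS =
          supported [set x in roots (adj G)].
  apply/vspaceP=> c; apply/idP/idP.
    case/memv_imgP=> b _ ->; apply/supportedP=> x; rewrite lfunE /= ffunE inE => xr.
    by rewrite big1 // => y /eqP E'; case/negP: xr; rewrite -E'; exact: roots_root.

  move/supportedP=> c0; rewrite (rfun_sum_delta c) memv_suml // => x _.
  have [|/c0->] := boolP (x \in [set x in roots (adj G)]); last by rewrite scale0r mem0v.
  rewrite inE => /eqP xr; rewrite -{2}xr -comp_sum_delta.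
  apply: memvZ; rewrite -[comp_sum _]lfunE; apply: memv_img.
  apply/supportedP=> v vf; rewrite ffunE.
  by case: eqP => // vE; rewrite -vE imset_f in vf.
rewrite !dim_supported card_imset // cardsE /toric_height /nb_components /n_comp_mem.
have -> : #|[predI roots (adj G) & predT]| = #|roots (adj G)|.
  by apply: eq_card => x; rewrite !inE andbT.
by move=> <- <-; rewrite -addnA addnK.
Qed.

End CycleDim.

(** * Congruences on flows *)

Lemma cong_map (M N : eqType) addM addN (phi : M -> N) (s : seq (M * M)) a b :
  {morph phi : x y / addM x y >-> addN x y} -> cong addM s a b ->
  cong addN [seq (phi g.1, phi g.2) | g <- s] (phi a) (phi b).
Proof.
move=> phiD; elim=> [{}a|{}a {}b c ab|{}a {}b _|{}a {}b c _ H1 _ H2].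
- exact: cong_refl.
- by rewrite !phiD; apply: cong_gen; exact: (map_f (fun g => (phi g.1, phi g.2)) ab).
- exact: cong_sym.
- exact: cong_trans H1 H2.
Qed.

Lemma cong_subset (M : eqType) add (s s' : seq (M * M)) a b :
  {subset s <= s'} -> cong add s a b -> cong add s' a b.
Proof.
move=> ss'; elim=> [{}a|{}a {}b c /ss' ab|{}a {}b _|{}a {}b c _ H1 _ H2].
- exact: cong_refl.
- exact: cong_gen.
- exact: cong_sym.
- exact: cong_trans H1 H2.
Qed.

Section Exponents.

Variable V : finType.
Implicit Types (E F : {set V * V}).

(** Exponents indexed by all ordered pairs, with the arc set imposed by [expo_supp]; flows on
    different arc sets thus share one type. *)
Definition expo := {ffun V * V -> nat}.
Implicit Types (a b : expo) (s : seq (expo * expo)).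

Definition expo_add a b : expo := [ffun p => (a p + b p)%N].
Definition expo_supp E a := forall p, p \notin E -> a p = 0%N.
Definition inflow a v := (\sum_(p | p.2 == v) a p)%N.
Definition outflow a v := (\sum_(p | p.1 == v) a p)%N.

Definition balanced a b :=
  forall v, (inflow a v + outflow b v = inflow b v + outflow a v)%N.

Definition presents E s :=
  (forall g, g \in s ->
     [/\ expo_supp E g.1, expo_supp E g.2 & balanced g.1 g.2]) /\
  (forall a b, expo_supp E a -> expo_supp E b -> balanced a b ->
     cong expo_add s a b).

(* Fewer generators than the dimension can be padded with zero binomials. *)
Definition complete_intersection E :=
  exists2 s, (size s <= \dim (cycles E))%N & presents E s.

End Exponents.

Lemma mnm_push0 (q n : nat) (e : 'I_q -> 'I_n) : mnm_push e 0%MM = 0%MM.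
Proof. by apply/mnmP=> i; rewrite mnm_pushE mnm0E big1 // => l _; rewrite mnm0E. Qed.

(** * From binomial ideals to congruences of flows *)

Section Transport.

Variables (k : fieldType) (G : sgraph) (o : rel G) (V : finType) (f : G -> V).
Hypotheses (oG : orientation o) (f_inj : injective f).

Let q := #|arcs o|.
Let E := pair_map f @: arcs o.
Let h (l : 'I_q) : 'I_#|G| := enum_rank (enum_val l).2.
Let t (l : 'I_q) : 'I_#|G| := enum_rank (enum_val l).1.

Lemma bci_presents :
  binomial_complete_intersection k o <->
  exists u v : 'I_(toric_height o) -> 'X_{1..q},
    (forall i, mnm_bal h t (u i) (v i)) /\
    (forall a b, mnm_bal h t a b ->
       cong (@mnm_add _) [seq (u i, v i) | i : 'I_(toric_height o)] a b).
Proof.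
split=> [[g [gX gker]]|[u [v uv]]].
  have [u uE] := fin_all_exists gX; have [v vE] := fin_all_exists uE.
  exists u, v; apply/(@laurent_kernel_generated k) => e.
  split=> [/gker[c ->]|[c ce]]; first by exists c; apply: eq_bigr => i _; rewrite -vE.
  by apply/gker; exists c; rewrite ce; apply: eq_bigr => i _; rewrite -vE.
exists (fun i => 'X_[u i] - 'X_[v i]); split=> [i|e]; first by exists (u i), (v i).
exact: (proj2 (@laurent_kernel_generated k _ _ h t _ u v) uv).
Qed.

Let arc_image (l : 'I_q) : V * V := pair_map f (enum_val l).

Let arc_image_inj : injective arc_image.
Proof. by move=> l l' /(pair_map_inj f_inj) /enum_val_inj. Qed.

Let arc_imageP p : p \in E -> exists l, arc_image l = p.
Proof.
case/imsetP=> p' p'o ->; exists (enum_rank_in p'o p').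
by rewrite /arc_image enum_rankK_in.
Qed.

(** The sum has at most one term; written this way, [phi] extends exponents by zero without a choice
    of index. It is inverse to [psi] on flows supported on [E]. *)
Let phi (m : 'X_{1..q}) : expo V := [ffun p => (\sum_(l | arc_image l == p) m l)%N].
Let psi (c : expo V) : 'X_{1..q} := [multinom c (arc_image l) | l < q].

Let phiD : {morph phi : x y / mnm_add x y >-> expo_add x y}.
Proof.
move=> x y; apply/ffunP=> p; rewrite !ffunE -big_split.
by apply: eq_bigr => l _; rewrite mnmDE.
Qed.

Let psiD : {morph psi : x y / expo_add x y >-> mnm_add x y}.
Proof. by move=> x y; apply/mnmP=> l; rewrite mnmDE !mnmE ffunE. Qed.

Let phi_arc m l : phi m (arc_image l) = m l.
Proof.
rewrite ffunE (bigD1 l) //= big1 ?addn0 // => l' /andP[/eqP /arc_image_inj ->].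
by rewrite eqxx.
Qed.

Let phiK m : psi (phi m) = m.
Proof. by apply/mnmP=> l; rewrite mnmE phi_arc. Qed.

Let phi_supp m : expo_supp E (phi m).
Proof.
move=> p pE; rewrite ffunE big1 // => l /eqP lp; case/negP: pE.
by rewrite -lp; apply: imset_f; exact: enum_valP.
Qed.

Let psiK c : expo_supp E c -> phi (psi c) = c.
Proof.
move=> cE; apply/ffunP=> p; have [/arc_imageP[l <-]|pE] := boolP (p \in E).
  by rewrite phi_arc mnmE.
by rewrite phi_supp ?cE.
Qed.

Let phi_sum (Q : pred (V * V)) m :
  (\sum_(p | Q p) phi m p = \sum_(l | Q (arc_image l)) m l)%N.
Proof.
rewrite (partition_big arc_image Q) //=; apply: eq_bigr => p Qp.
rewrite ffunE; apply: eq_bigl => l.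
by case: eqP => [->|]; rewrite ?Qp ?andbF.
Qed.

Let balanced_phi a b : balanced (phi a) (phi b) <-> mnm_bal h t a b.
Proof.
rewrite /balanced /inflow /outflow /mnm_bal.
have push_h m x : mnm_push h m (enum_rank x) = (\sum_(p | p.2 == f x) phi m p)%N.
  rewrite mnm_pushE phi_sum; apply: eq_bigl => l.
  by rewrite /= (inj_eq enum_rank_inj) (inj_eq f_inj).
have push_t m x : mnm_push t m (enum_rank x) = (\sum_(p | p.1 == f x) phi m p)%N.
  rewrite mnm_pushE phi_sum; apply: eq_bigl => l.
  by rewrite /= (inj_eq enum_rank_inj) (inj_eq f_inj).
split=> [bal|/mnmP bal v].
  by apply/mnmP=> i; rewrite -(enum_valK i) !mnmDE !push_h !push_t.
(* No arc of [E] meets a vertex outside the image of [f], so all flows vanish there. *)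
have [/imsetP[x _ ->]|vf] := boolP (v \in [set f x | x : G]).
  by have := bal (enum_rank x); rewrite !mnmDE !push_h !push_t.
rewrite !phi_sum !big1 // => l /eqP lv; case/negP: vf; rewrite -lv; exact: imset_f.
Qed.

(** Generators and chains are carried across by [phi] and [psi], and [dim_cycles] matches the two
    counts. *)
Lemma bci_complete_intersection :
  binomial_complete_intersection k o <-> complete_intersection E.
Proof.
rewrite bci_presents /complete_intersection dim_cycles //; split.
  move=> [u [v [bal gen]]].
  exists [seq (phi g.1, phi g.2) | g <- [seq (u i, v i) | i : 'I_(toric_height o)]].
    by rewrite !size_map -enumT size_enum_ord.
  split=> [g /mapP[_ /mapP[i _ ->] ->] /=|a b aE bE ab].
    by split; [exact: phi_supp|exact: phi_supp|exact/balanced_phi].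
  rewrite -(psiK aE) -(psiK bE); apply: cong_map phiD _; apply: gen.
  by apply/balanced_phi; rewrite !psiK.
move=> [s szs [bal gen]].
(* The default pair [(0, 0)] stands for the zero binomial and pads the list to the exact height. *)
pose r (i : 'I_(toric_height o)) := nth (0, 0)%MM [seq (psi g.1, psi g.2) | g <- s] i.
exists (fst \o r), (snd \o r); split=> [i|a b ab].
  have [lt_i|ge_i] := ltnP i (size s); last first.
    by rewrite /r /= nth_default ?size_map // /mnm_bal !mnm_push0.
  have g_s : nth ([ffun => 0%N], [ffun => 0%N]) s i \in s by exact: mem_nth.
  have [g1 g2 g12] := bal _ g_s; apply/balanced_phi.
  by rewrite /r /= (nth_map ([ffun => 0%N], [ffun => 0%N])) //= !psiK.
rewrite -(phiK a) -(phiK b).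
apply: (cong_subset (s := [seq (psi g.1, psi g.2) | g <- s])).
  move=> g /(nthP (0, 0)%MM)[i]; rewrite size_map => lt_i <-.
  apply/mapP; exists (Ordinal (leq_trans lt_i szs)); first exact: mem_enum.
  by rewrite /= -surjective_pairing.
by apply: cong_map psiD _; apply: gen; rewrite ?balanced_phi //; exact: phi_supp.
Qed.

End Transport.

(** * Gluing presentations and restricting them to a subset of the arcs *)

Section Presentations.

Variable V : finType.
Implicit Types (E F : {set V * V}) (a b c : expo V) (s : seq (expo V * expo V)).

Definition restrict F a : expo V := [ffun p => if p \in F then a p else 0%N].

(** The property of the arcs of a block on which both gluing and restriction rest. *)
Definition splits E F :=
  forall a b, expo_supp E a -> expo_supp E b -> balanced a b ->
    balanced (restrict F a) (restrict F b).

Lemma expo_addC : commutative (@expo_add V).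
Proof. by move=> a b; apply/ffunP=> p; rewrite !ffunE addnC. Qed.

Lemma expo_addA : associative (@expo_add V).
Proof. by move=> a b c; apply/ffunP=> p; rewrite !ffunE addnA. Qed.

Lemma expo_suppD E a b :
  expo_supp E (expo_add a b) <-> expo_supp E a /\ expo_supp E b.
Proof.
split=> [ab|[a0 b0] p pE]; last by rewrite ffunE a0 ?b0.
by split=> p /ab; rewrite ffunE => /eqP; rewrite addn_eq0 => /andP[/eqP a0 /eqP b0].
Qed.

Lemma expo_supp_subset E F a : F \subset E -> expo_supp F a -> expo_supp E a.
Proof. by move=> FE aF p pE; apply: aF; apply: contraNN pE => /(subsetP FE). Qed.

Lemma restrict_supp F a : expo_supp F (restrict F a).
Proof. by move=> p /negPf pF; rewrite ffunE pF. Qed.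

Lemma restrictK F a : expo_supp F a -> restrict F a = a.
Proof. by move=> aF; apply/ffunP=> p; rewrite ffunE; case: ifPn => // /aF. Qed.

Lemma restrict_split F a : a = expo_add (restrict F a) (restrict (~: F) a).
Proof. by apply/ffunP=> p; rewrite !ffunE inE; case: (p \in F); rewrite ?addn0. Qed.

Lemma inflowD a b v : inflow (expo_add a b) v = (inflow a v + inflow b v)%N.
Proof. by rewrite /inflow -big_split; apply: eq_bigr => p _; rewrite ffunE. Qed.

Lemma outflowD a b v : outflow (expo_add a b) v = (outflow a v + outflow b v)%N.
Proof. by rewrite /outflow -big_split; apply: eq_bigr => p _; rewrite ffunE. Qed.

Lemma balanced_sym a b : balanced a b -> balanced b a.
Proof. by move=> ab v; have := ab v; lia. Qed.

Lemma balanced_cancel a b c e :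
  balanced (expo_add a c) (expo_add b e) -> balanced a b -> balanced c e.
Proof.
move=> abce ab v; have := abce v; have := ab v; rewrite !inflowD !outflowD.
lia.
Qed.

(** Translation invariance, built into [cong] only for generators, extends to chains. *)
Lemma cong_addr s a b c :
  cong (@expo_add V) s a b -> cong (@expo_add V) s (expo_add a c) (expo_add b c).
Proof.
elim=> [{}a|{}a {}b e ab|{}a {}b _|{}a {}b e _ H1 _ H2].
- exact: cong_refl.
- by rewrite -!expo_addA; apply: cong_gen.
- exact: cong_sym.
- exact: cong_trans H1 H2.
Qed.

Lemma complete_intersection0 : complete_intersection (set0 : {set V * V}).
Proof.
exists [::] => //; split=> // a b a0 b0 _.
suff -> : a = b by exact: cong_refl.
by apply/ffunP=> p; rewrite a0 ?b0 ?inE.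
Qed.

(** The parts of a balanced pair in [F] and outside [F] are both balanced. The first is moved by the
    generators of [F] while the rest is carried along, then the second by those of [E]. *)
Lemma complete_intersectionU E F : [disjoint F & E] -> splits (F :|: E) F ->
  complete_intersection F -> complete_intersection E ->
  complete_intersection (F :|: E).
Proof.
move=> dis spl [s szs [s_bal s_gen]] [r szr [r_bal r_gen]].
exists (s ++ r).
  by rewrite size_cat (leq_trans (leq_add szs szr)) // dim_cyclesU.
split=> [g|a b aFE bFE ab].
  rewrite mem_cat => /orP[/s_bal|/r_bal] [g1 g2 bal]; split=> //;
    by [apply: expo_supp_subset g1; rewrite ?subsetUl ?subsetUr
       |apply: expo_supp_subset g2; rewrite ?subsetUl ?subsetUr].
have abF := spl _ _ aFE bFE ab.
have abE : balanced (restrict (~: F) a) (restrict (~: F) b).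
  by apply: balanced_cancel abF; rewrite -!restrict_split.
have suppE c : expo_supp (F :|: E) c -> expo_supp E (restrict (~: F) c).
  move=> cFE p pE; rewrite ffunE inE; case: ifPn => // pF.
  by rewrite cFE ?inE // negb_or pF.
rewrite (restrict_split F a) (restrict_split F b).
apply: (@cong_trans _ _ _ _ (expo_add (restrict F b) (restrict (~: F) a))).
  apply: cong_addr; apply: (cong_subset (s := s)) => [g gs|].
    by rewrite mem_cat gs.
  by apply: s_gen => //; exact: restrict_supp.
rewrite ![expo_add (restrict F b) _]expo_addC.
apply: cong_addr; apply: (cong_subset (s := r)) => [g gr|].
  by rewrite mem_cat gr orbT.
by apply: r_gen => //; exact: suppE.
Qed.

Lemma sum_flow (w : V -> nat) a :
  (\sum_v w v * inflow a v = \sum_p w p.2 * a p)%N /\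
  (\sum_v w v * outflow a v = \sum_p w p.1 * a p)%N.
Proof.
rewrite /inflow /outflow; split.
  rewrite (partition_big (fun p : V * V => p.2) predT) //=.
  by apply: eq_bigr => v _; rewrite big_distrr; apply: eq_bigr => p /eqP->.
rewrite (partition_big (fun p : V * V => p.1) predT) //=.
by apply: eq_bigr => v _; rewrite big_distrr; apply: eq_bigr => p /eqP->.
Qed.

(* The arcs outside [F] increase the potential [w], so a flow through them
   cannot be closed. *)
Lemma acyclic_supp E F (w : V -> nat) a b :
  (forall p, p \in E -> p \notin F -> (w p.1 < w p.2)%N) -> splits E F ->
  F \subset E -> expo_supp E b -> balanced a b ->
  expo_supp F a -> expo_supp F b.
Proof.
move=> wE spl FE bE ab aF.
have abF := spl _ _ (expo_supp_subset FE aF) bE ab.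
pose b' := restrict (~: F) b.
have b'0 v : inflow b' v = outflow b' v.
  have := ab v; have := abF v; rewrite (restrictK aF).
  have : inflow b v = (inflow (restrict F b) v + inflow b' v)%N.
    by rewrite -inflowD -restrict_split.
  have : outflow b v = (outflow (restrict F b) v + outflow b' v)%N.
    by rewrite -outflowD -restrict_split.
  lia.
have [sum_in sum_out] := sum_flow w b'.
have wb' : (\sum_p w p.1 * b' p = \sum_p w p.2 * b' p)%N.
  by rewrite -sum_in -sum_out; apply: eq_bigr => v _; rewrite b'0.
(* The weighted totals over tails and heads agree, so equality holds arc by arc; as [w] strictly
   increases along arcs outside [F], [b'] must vanish there. *)
have le_w p : (w p.1 * b' p <= w p.2 * b' p ?= iff (w p.1 * b' p == w p.2 * b' p))%N.
  split=> //; rewrite ffunE inE; case: ifPn => pF; last by rewrite !muln0.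
  have [pE|/bE->] := boolP (p \in E); last by rewrite !muln0.
  by rewrite leq_mul2r ltnW ?orbT ?wE.
have /= := leqif_sum (fun p (_ : true) => le_w p).
case=> _; rewrite wb' eqxx => /esym/forallP/= eq_w p pF.
have [pE|/bE//] := boolP (p \in E).
have := eq_w p; rewrite ffunE inE pF /= eqn_mul2r => /orP[/eqP//|/eqP wp].
by have := wE p pE pF; rewrite wp ltnn.
Qed.

Definition diff_vec (g : expo V * expo V) : rfun (V * V)%type :=
  [ffun p => (g.1 p)%:R - (g.2 p)%:R].

(** A move adds the same flow to both sides of a generator, hence has the same difference vector;
    along a chain these vectors add up. *)
Lemma cong_span s a b : cong (@expo_add V) s a b ->
  diff_vec (a, b) \in <<[seq diff_vec g | g <- s]>>%VS.
Proof.
elim=> [{}a|{}a {}b c ab|{}a {}b _|{}a {}b c _ H1 _ H2].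
- suff -> : diff_vec (a, a) = 0 by exact: mem0v.
  by apply/ffunP=> p; rewrite !ffunE subrr.
- suff -> : diff_vec (expo_add a c, expo_add b c) = diff_vec (a, b).
    by apply/memv_span/map_f.
  by apply/ffunP=> p; rewrite !ffunE /= !natrD; lra.
- suff -> : diff_vec (b, a) = - diff_vec (a, b) by rewrite memvN.
  by apply/ffunP=> p; rewrite !ffunE opprB.
- suff -> : diff_vec (a, c) = diff_vec (a, b) + diff_vec (b, c) by rewrite memvD.
  by apply/ffunP=> p; rewrite !ffunE subrKA.
Qed.

(** Denominators are cleared with [D], and the integral cycle is split into its positive and
    negative parts. *)
Lemma cycles_integral E (c : rfun (V * V)%type) : c \in cycles E ->
  exists a b (d : rat), [/\ expo_supp E a, expo_supp E b, balanced a b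
    & c = d *: diff_vec (a, b)].
Proof.
case/cyclesP=> cE /ffunP c0.
pose D : int := \prod_p denq (c p).
have D0 : D != 0 by apply/prodf_neq0 => p _; exact: denq_neq0.
have [z zE] : exists z : {ffun V * V -> int}, forall p, c p * D%:~R = (z p)%:~R.
  exists [ffun p => numq (c p) * \prod_(p' | p' != p) denq (c p')] => p.
  rewrite ffunE /D (bigD1 p) //= !rmorphM /= mulrA; congr (_ * _).
  by rewrite -{1}(divq_num_den (c p)) divfK // intr_eq0 denq_neq0.
have DQ0 : (D%:~R : rat) != 0 by rewrite intr_eq0.
pose a : expo V := [ffun p => if z p is Posz m then m else 0%N].
(* [Negz m] denotes [-(m + 1)], hence the successor. *)
pose b : expo V := [ffun p => if z p is Negz m then m.+1 else 0%N].
have abz p : (a p)%:R - (b p)%:R = (z p)%:~R :> rat.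
  by rewrite !ffunE; case: (z p) => m; rewrite ?subr0 // sub0r NegzE mulrNz.
have z0 p : p \notin E -> z p = 0.
  by move=> /cE cp; apply/eqP; rewrite -(intr_eq0 rat) -zE cp mul0r.
exists a, b, D%:~R^-1; split.
- by move=> p /z0 zp; rewrite ffunE zp.
- by move=> p /z0 zp; rewrite ffunE zp.
- have sumE (Q : pred (V * V)) : (\sum_(p | Q p) (c p : rat)) * D%:~R =
      (\sum_(p | Q p) a p)%N%:R - (\sum_(p | Q p) b p)%N%:R.
    rewrite mulr_suml !natr_sum -sumrB.
    by apply: eq_bigr => p _; rewrite abz -zE.
  move=> v; apply/eqP; rewrite -(Num.Theory.eqr_nat rat) !natrD.
  have := c0 v; rewrite !ffunE => /(congr1 (fun x : rat => x * D%:~R)).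
  rewrite mul0r mulrBl !sumE /inflow /outflow.
  by move=> E0; apply/eqP; lra.
apply/ffunP=> p; rewrite [RHS]ffunE.
have -> : diff_vec (a, b) p = c p * D%:~R by rewrite zE -abz [LHS]ffunE.
by rewrite /GRing.scale /= mulrC mulfK.
Qed.

(** The generators supported on [F] are kept. By [acyclic_supp] a chain that starts on [F] stays
    there and uses only these, while the discarded generators span the image of the cycles under
    [off F]. *)
Lemma complete_intersection_restrict E F (w : V -> nat) :
  (forall p, p \in E -> p \notin F -> (w p.1 < w p.2)%N) -> splits E F ->
  F \subset E -> complete_intersection E -> complete_intersection F.
Proof.
move=> wE spl FE [s szs [s_bal s_gen]].
have suppP a : reflect (expo_supp F a) [forall p, (p \notin F) ==> (a p == 0%N)].
  by apply: (iffP forallP) => aF p; [move=> pF; apply/eqP; move: (aF p); rewrite pF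
    |apply/implyP => /aF ->].
pose inF (g : expo V * expo V) := [forall p, (p \notin F) ==> (g.1 p == 0%N)].
have inF2 g : g \in s -> inF g -> expo_supp F g.1 /\ expo_supp F g.2.
  move=> /s_bal[g1 g2 bal] /suppP gF; split=> //.
  exact: acyclic_supp wE spl FE g2 bal gF.
exists (filter inF s).
  (* By [dim_cycles_off], discarding at least this many generators leaves at most
     [\dim (cycles F)]. *)
  suff : (\dim (linfun (off F) @: cycles E) <= count (predC inF) s)%N.
    have := dim_cycles_off FE; have := count_predC inF s; rewrite size_filter.
    move: szs; set x := \dim _; set y := \dim _; set z := \dim _; lia.
  rewrite -size_filter -(size_map (linfun (off F) \o diff_vec)).
  rewrite (leq_trans _ (dim_span _)) // dimvS //.
  apply/subvP=> _ /memv_imgP[c /cycles_integral[a [b [d [aE bE ab ->]]]] ->].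
  rewrite linearZ memvZ //.
  have := memv_img (linfun (off F)) (cong_span (s_gen _ _ aE bE ab)).
  rewrite limg_span -map_comp; apply: subvP; apply/span_subvP=> _ /mapP[g gs ->].
  have [gF|gF] := boolP (inF g); last first.
    by apply/memv_span/map_f; rewrite mem_filter /= gF.
  have [g1 g2] := inF2 _ gs gF.
  suff -> : (linfun (off F) \o diff_vec) g = 0 by exact: mem0v.
  rewrite /= lfunE; apply/ffunP=> p; rewrite !ffunE.
  by case: ifPn => // pF; rewrite g1 ?g2 ?subrr.
split=> [g|a b aF bF ab].
  rewrite mem_filter => /andP[gF gs]; have [g1 g2] := inF2 _ gs gF.
  by split=> //; case: (s_bal _ gs).
have FEsupp := expo_supp_subset FE.
have : cong (@expo_add V) s a b by exact: s_gen (FEsupp _ aF) (FEsupp _ bF) ab.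
(* The supports are compared by an equivalence so that the induction passes through symmetry. *)
suff H x y : cong (@expo_add V) s x y -> (expo_supp F x <-> expo_supp F y) /\
    (expo_supp F x -> cong (@expo_add V) (filter inF s) x y).
  by case/H=> _; apply.
elim=> [{}x|{}x {}y c xy|{}x {}y _ [eqF IH]|{}x {}y c _ [eqF1 IH1] _ [eqF2 IH2]].
- by split=> // _; exact: cong_refl.
- have [/= x1 y1 bal] := s_bal _ xy.
  rewrite !expo_suppD; split.
    split=> -[gF cF]; split=> //; first exact: acyclic_supp wE spl FE y1 bal gF.
    exact: acyclic_supp wE spl FE x1 (balanced_sym bal) gF.
  move=> [xF _]; apply: cong_gen; rewrite mem_filter xy andbT; exact/suppP.
- by split=> [|yF]; [symmetry|apply/cong_sym/IH/eqF].
- split=> [|xF]; first exact: iff_trans eqF1 eqF2.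
  by apply: cong_trans (IH1 xF) (IH2 _); apply/eqF1.
Qed.

End Presentations.

(** * Blocks *)

Lemma connect_map (T S : finType) (e : rel T) (e' : rel S) (f : T -> S) x y :
  (forall a b, e a b -> e' (f a) (f b)) -> connect e x y -> connect e' (f x) (f y).
Proof.
move=> ee' /connectP[p]; elim: p x => [x _ ->|z p IHp x /= /andP[xz zp] yp].
  exact: connect0.
exact: connect_trans (connect1 (ee' _ _ xz)) (IHp _ zp yp).
Qed.

Lemma path_connect_in (T : finType) (P : pred T) (e : rel T) x p :
  path e x p -> all P (x :: p) ->
  connect [rel a b | [&& P a, P b & e a b]] x (last x p).
Proof.
elim: p x => [x _ _|z p IHp x /= /andP[xz zp] /and3P[Px Pz Pp]].
  exact: connect0.
apply: connect_trans (IHp _ zp _); last by rewrite /= Pz Pp.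
by apply: connect1; rewrite /= Px Pz xz.
Qed.

Section Blocks.

Variable G : sgraph.
Implicit Types (B C : subgraph G) (u v w x y : G).

Definition avoid w (r : rel G) : rel G := [rel a b | [&& a != w, b != w & r a b]].

Lemma avoid_sym w (r : rel G) : ssrbool.symmetric r -> connect_sym (avoid w r).
Proof. by move=> rs; apply: sym_connect_sym => a b; rewrite /avoid /= rs andbCA. Qed.

Lemma avoid_connect w (r : rel G) x y : connect (avoid w r) x y -> connect r x y.
Proof. by apply: connect_map => a b /and3P[]. Qed.

Lemma avoid_sub w (r r' : rel G) x y :
  subrel r r' -> connect (avoid w r) x y -> connect (avoid w r') x y.
Proof.
move=> rr'; apply: (connect_map (f := id)) => a b /and3P[aw bw /rr' ab].
by rewrite /avoid /= aw bw.
Qed.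

(** [connected_no_cut_vertex] restated on the vertices of [G] instead of the subtype attached to
    [B], so that different subgraphs can be compared and united. *)
Definition biconnected B : Prop :=
  [/\ exists x, x \in sverts B,
      forall x y, x \in sverts B -> y \in sverts B -> connect (sadj B) x y
    & forall w x y, x \in sverts B -> y \in sverts B -> x != w -> y != w ->
        connect (avoid w (sadj B)) x y].

Lemma sadj_verts B x y : sadj B x y -> (x \in sverts B) && (y \in sverts B).
Proof. by move=> /(sadj_sub (s := B)) /and3P[-> ->]. Qed.

Lemma connect_sub_lift B (e : rel G) (x y : {x : G | x \in sverts B}) :
  subrel e (sadj B) -> connect e (val x) (val y) ->
  connect [rel a b : {x : G | x \in sverts B} | e (val a) (val b)] x y.
Proof.
move=> eB /connectP[p]; elim: p x => [x _ /val_inj->|z p IHp x /= /andP[xz zp] yp].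
  exact: connect0.
have /andP[_ zB] := sadj_verts (eB _ _ xz).
by apply: connect_trans (connect1 _) (IHp (Sub z zB) zp yp); rewrite //= xz.
Qed.

Lemma biconnectedP B : connected_no_cut_vertex B <-> biconnected B.
Proof.
split=> [[[cardB conB] ncut]|[[x0 x0B] conB avoidB]].
  have conS x y : x \in sverts B -> y \in sverts B -> connect (sadj B) x y.
    move=> xB yB.
    exact: (@connect_map _ _ _ (sadj B) val _ _ _ (conB (Sub x xB) (Sub y yB))).
  split=> // [|w x y xB yB xw yw].
    by case/card_gt0P: cardB => x _; exists (val x); exact: (valP x).
  have [wB|wB] := boolP (w \in sverts B); last first.
    apply: (connect_map (f := id)) (conS x y xB yB) => a b /= ab.
    have /andP[aB bB] := sadj_verts ab; rewrite /avoid /= ab andbT.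
    by apply/andP; split; apply: contraNneq wB => <-.
  case: (boolP (connect (avoid w (sadj B)) x y)) => // ncon; case: ncut.
  exists (Sub w wB : B), (Sub x xB), (Sub y yB); split=> //.
  apply: contraNN ncon.
  exact: (@connect_map _ _ _ (avoid w (sadj B)) val).
split.
  split=> [|x y]; first by apply/card_gt0P; exists (Sub x0 x0B).
  by apply: (connect_sub_lift (e := sadj B)) => //; apply: conB; exact: valP.
move=> [w [x [y [xw yw _ /negP]]]]; apply.
have := @connect_sub_lift B (avoid (val w) (sadj B)) x y.
by apply=> [a b /and3P[]//|]; apply: avoidB => //; exact: valP.
Qed.

Section Union.

Variables (B C : subgraph G).

Let union_sym : ssrbool.symmetric [rel a b | sadj B a b || sadj C a b].
Proof. by move=> a b /=; congr (_ || _); apply: sadj_sym. Qed.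

Let union_sub x y : [rel a b | sadj B a b || sadj C a b] x y ->
  [&& x \in sverts B :|: sverts C, y \in sverts B :|: sverts C & adj G x y].
Proof.
by rewrite !inE => /orP[] /(sadj_sub (s := _)) /and3P[-> -> ->]; rewrite ?orbT.
Qed.

Definition sunion : subgraph G := Subgraph union_sym union_sub.

End Union.

Section Induced.

Variable s : seq G.

Let induced_sym : ssrbool.symmetric [rel a b | [&& a \in s, b \in s & adj G a b]].
Proof. by move=> a b; rewrite /= adj_sym andbCA. Qed.

Let induced_sub x y : [rel a b | [&& a \in s, b \in s & adj G a b]] x y ->
  [&& x \in [set a in s], y \in [set a in s] & adj G x y].
Proof. by rewrite !inE. Qed.

Definition sinduced : subgraph G := Subgraph induced_sym induced_sub.

End Induced.

Lemma subgraph_le_refl B : subgraph_le B B.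
Proof. by split. Qed.

Lemma subgraph_le_trans B C D :
  subgraph_le B C -> subgraph_le C D -> subgraph_le B D.
Proof.
move=> [vBC eBC] [vCD eCD].
by split=> [|a b /eBC /eCD]; first exact: subset_trans vCD.
Qed.

(** After the deletion of any [w], each remaining vertex of [C] still reaches [B], and inside [B]
    any two remaining vertices are joined. *)
Lemma biconnected_sunion B C : biconnected B ->
  (forall w x, x \in sverts C -> x != w -> exists y,
     [/\ y \in sverts B, y != w & connect (avoid w (sadj C)) x y]) ->
  biconnected (sunion B C).
Proof.
move=> [[x0 x0B] conB avoidB] CB.
have subB : subrel (sadj B) (sadj (sunion B C)) by move=> a b /= ->.
have subC : subrel (sadj C) (sadj (sunion B C)) by move=> a b /= ->; rewrite orbT.
have toB w x : x \in sverts (sunion B C) -> x != w -> exists y,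
    [/\ y \in sverts B, y != w & connect (avoid w (sadj (sunion B C))) x y].
  rewrite inE => /orP[xB xw|xC /(CB _ _ xC)[y [yB yw xy]]].
    by exists x; rewrite connect0.
  by exists y; split=> //; apply: avoid_sub xy.
have avoidU w x y : x \in sverts (sunion B C) -> y \in sverts (sunion B C) ->
    x != w -> y != w -> connect (avoid w (sadj (sunion B C))) x y.
  move=> xU yU /(toB _ _ xU)[x' [x'B x'w xx']] /(toB _ _ yU)[y' [y'B y'w yy']].
  apply: connect_trans xx' _; rewrite avoid_sym; last exact: sadj_sym.
  apply: connect_trans yy' _; apply: avoid_sub subB _; exact: avoidB.
have toB' x : x \in sverts (sunion B C) ->
    exists2 y, y \in sverts B & connect (sadj (sunion B C)) x y.
  move=> xU; have [xB|xB] := boolP (x \in sverts B); first by exists x.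
  (* The deleted vertex is taken to be [x0], which lies in [B] and so differs from [x]. *)
  have [|y [yB _ /avoid_connect xy]] := toB x0 x xU; last by exists y.
  by apply: contraNneq xB => ->.
split=> // [|x y /toB'[x' x'B xx'] /toB'[y' y'B yy']].
  by exists x0; rewrite inE x0B.
apply: connect_trans xx' _.
rewrite (sym_connect_sym (sadj_sym (sunion B C))); apply: connect_trans yy' _.
by apply: (connect_map (f := id)) (conB _ _ y'B x'B) => a b /subB.
Qed.

(** The union with [C] contains [B] and has no cut vertex, so maximality of [B] applies to it. *)
Lemma block_absorbs B C : is_block B ->
  (forall w x, x \in sverts C -> x != w -> exists y,
     [/\ y \in sverts B, y != w & connect (avoid w (sadj C)) x y]) ->
  subgraph_le C B.
Proof.
move=> [/biconnectedP bB maxB] CB.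
have leU : subgraph_le (sunion B C) B.
  apply: maxB; first by apply/biconnectedP; exact: biconnected_sunion.
  by split=> [|a b /= ->//]; exact: subsetUl.
by apply: subgraph_le_trans leU; split=> [|a b /= ->]; [exact: subsetUr|rewrite orbT].
Qed.

(** At least one end of the common edge survives the deletion of [w], and [C] connects its other
    vertices to that end. *)
Lemma block_shared_edge B C x y : is_block B -> connected_no_cut_vertex C ->
  sadj B x y -> sadj C x y -> subgraph_le C B.
Proof.
move=> bB /biconnectedP[_ _ avoidC] Bxy Cxy.
have /andP[xB yB] := sadj_verts Bxy; have /andP[xC yC] := sadj_verts Cxy.
have xy : x != y.
  apply: contraTneq Bxy => ->; apply/negP => /(sadj_sub (s := _)).
  by rewrite adj_irr !andbF.
apply: block_absorbs => // w z zC zw.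
have [xw|xw] := eqVneq x w; last by exists x; split=> //; exact: avoidC.
by exists y; rewrite -xw eq_sym; split=> //; apply: avoidC; rewrite // ?xw // -xw eq_sym.
Qed.

(* Otherwise a simple path outside [B] joining two vertices of [B] could be
   added to [B] without creating a cut vertex. *)
Lemma block_separated B u v : is_block B -> u \in sverts B -> v \in sverts B ->
  connect [rel a b | adj G a b && ~~ sadj B a b] u v -> u = v.
Proof.
move=> bB uB vB /connectP[p0 p0u vE]; apply/eqP/negPn/negP => uv; move: vE.
case/shortenP: p0u => p pu up _ vE.
have adjp : path (adj G) u p by apply: sub_path pu => a b /andP[].
have leB : subgraph_le (sinduced (u :: p)) B.
  apply: block_absorbs => // w x; rewrite inE => xp xw.
  have con_seg z q : path (adj G) z q -> {subset z :: q <= u :: p} -> w \notin z :: q ->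
      connect (avoid w (sadj (sinduced (u :: p)))) z (last z q).
    move=> zq sub wq.
    have in_zq : all (fun a => (a != w) && (a \in u :: p)) (z :: q).
      by apply/allP => a aq; rewrite sub // andbT; apply: contraNneq wq => <-.
    have := path_connect_in zq in_zq; apply: (connect_map (f := id)).
    move=> a b /= /and3P[/andP[aw aP] /andP[bw bP] ab].
    by rewrite /avoid /= aw bw aP bP.
  case/splitPl: xp adjp up vE con_seg => p1 p2 xE.
  rewrite cat_path last_cat xE -cat_cons cat_uniq.
  move=> /andP[up1 xp2] /and3P[_ dis _] vE con_seg.
  (* The path is simple, so [w] lies on at most one side of [x]; the other side leads to an end of
     the path, which belongs to [B]. *)
  have [wp1|wp1] := boolP (w \in u :: p1).
    have wp2 : w \notin x :: p2.
      rewrite inE negb_or eq_sym xw; apply: contraNN dis => wp2.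
      by apply/hasP; exists w.
    exists v; rewrite vB; split=> //.
      by apply: contraNneq wp2 => <-; rewrite vE mem_last.
    rewrite vE; apply: con_seg => // a; rewrite inE mem_cat => /orP[/eqP->|->].
      by rewrite -xE mem_last.
    by rewrite orbT.
  exists u; rewrite uB; split=> //.
    by apply: contraNneq wp1 => <-; rewrite mem_head.
  rewrite avoid_sym; last exact: sadj_sym.
  by rewrite -xE; apply: con_seg => // a ap1; rewrite mem_cat ap1.
(* The first edge of the path was chosen outside [B], yet [B] absorbs it. *)
case: p pu vE leB {up adjp} => [|z p] /=; first by move=> _ vu; rewrite vu eqxx in uv.
move=> /andP[/andP[uz nuz] _] _ [_ /(_ u z) H].
by case/negP: nuz; apply: H; rewrite /= !inE !eqxx orbT.
Qed.

(** A proper enlargement misses fewer vertices or edges of [G], so [mu] decreases and the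
    enlargements end at a block. *)
Lemma exists_block C : connected_no_cut_vertex C ->
  exists2 B, is_block B & subgraph_le C B.
Proof.
pose edges B := [set p : G * G | sadj B p.1 p.2].
pose mu B := (#|~: sverts B| + #|~: edges B|)%N.
have [n] := ubnP (mu C); elim: n C => // n IHn C muC bC.
have [blockC|nblock] := classic (is_block C).
  by exists C => //; exact: subgraph_le_refl.
have [D [bD CD nDC]] : exists D : subgraph G,
    [/\ connected_no_cut_vertex D, subgraph_le C D & ~ subgraph_le D C].
  apply: NNPP => none; apply: nblock; split=> // D bD CD.
  by apply: NNPP => nDC; apply: none; exists D.
suff muD : (mu D < n)%N.
  have [B bB DB] := IHn D muD bD.
  by exists B => //; exact: subgraph_le_trans CD DB.
rewrite -ltnS; apply: leq_trans muC; rewrite ltnS.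
case: CD => vCD eCD; have eCD' : edges C \subset edges D.
  by apply/subsetP => p; rewrite !inE; exact: eCD.
have le_v : (#|~: sverts D| <= #|~: sverts C|)%N by rewrite subset_leq_card ?setCS.
have le_e : (#|~: edges D| <= #|~: edges C|)%N by rewrite subset_leq_card ?setCS.
rewrite ltnNge; apply/negP => le_mu; apply: nDC.
have /eqP eq_v : ~: sverts D == ~: sverts C.
  by rewrite eqEcard setCS vCD; move: le_mu; rewrite /mu; lia.
have /eqP eq_e : ~: edges D == ~: edges C.
  by rewrite eqEcard setCS eCD'; move: le_mu; rewrite /mu; lia.
split; first by rewrite -setCS eq_v.
move=> a b ab; have : (a, b) \in edges D by rewrite inE.
by rewrite -[edges D]setCK eq_e setCK inE.
Qed.

Lemma biconnected_edge x y : adj G x y -> biconnected (sinduced [:: x; y]).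
Proof.
move=> xy; have yx : adj G y x by rewrite adj_sym.
have con a b : a \in [set c in [:: x; y]] -> b \in [set c in [:: x; y]] ->
    (a == b) || sadj (sinduced [:: x; y]) a b.
  by rewrite !inE => /orP[] /eqP-> /orP[] /eqP->; rewrite /= !inE ?eqxx ?xy ?yx ?orbT.
split=> [|a b aE bE|w a b aE bE aw bw]; first by exists x; rewrite !inE eqxx.
  by have /orP[/eqP->|ab] := con a b aE bE; [exact: connect0|exact: connect1].
have /orP[/eqP->|ab] := con a b aE bE; first exact: connect0.
by apply: connect1; rewrite /avoid /= aw bw.
Qed.

Lemma edge_in_block x y : adj G x y -> exists2 B, is_block B & sadj B x y.
Proof.
move=> xy; have /biconnectedP/exists_block[B bB [_ leB]] := biconnected_edge xy.
by exists B => //; apply: leB; rewrite /= !inE !eqxx orbT.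
Qed.

(** * Flows on the arcs of a block *)

Definition block_arcs B (o : rel G) : {set G * G} :=
  [set p in arcs o | sadj B p.1 p.2].

Lemma block_arcs_sub B o : block_arcs B o \subset arcs o.
Proof. by apply/subsetP => p; rewrite inE => /andP[]. Qed.

Lemma sum_inflow (A : {set G}) (a : expo G) :
  (\sum_(x in A) inflow a x = \sum_(p | p.2 \in A) a p)%N.
Proof.
rewrite /inflow (partition_big (fun p => p.2) (mem A)) //=.
apply: eq_bigr => x xA; apply: eq_bigl => p.
by case: eqP => [->|]; rewrite ?xA ?andbF.
Qed.

Lemma sum_outflow (A : {set G}) (a : expo G) :
  (\sum_(x in A) outflow a x = \sum_(p | p.1 \in A) a p)%N.
Proof.
rewrite /outflow (partition_big (fun p => p.1) (mem A)) //=.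
apply: eq_bigr => x xA; apply: eq_bigl => p.
by case: eqP => [->|]; rewrite ?xA ?andbF.
Qed.

(* The conservation law is summed over the component of [v] in [G] without the
   edges of [B]: this component meets [B] only in [v]. *)
Lemma block_splits B o : orientation o -> is_block B ->
  splits (arcs o) (block_arcs B o).
Proof.
move=> [oadj _] bB a b ao bo ab v; set F := block_arcs B o.
have notB c x : x \notin sverts B ->
    inflow (restrict F c) x = 0%N /\ outflow (restrict F c) x = 0%N.
  move=> xB; rewrite /inflow /outflow !big1 // => p /eqP px; rewrite ffunE inE;
  by case: ifP => // /andP[_ /sadj_verts]; rewrite px (negPf xB) ?andbF.
have [vB|vB] := boolP (v \in sverts B); last first.
  by have [-> ->] := notB a v vB; have [-> ->] := notB b v vB.
pose e : rel G := [rel x y | adj G x y && ~~ sadj B x y].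
have e_sym : connect_sym e.
  by apply: sym_connect_sym => x y; rewrite /e /= adj_sym sadj_sym.
pose A := [set x | connect e v x].
have onlyv x : x \in A -> x != v -> x \notin sverts B.
  by rewrite inE => vx; apply: contraNN => xB; apply/eqP/esym; exact: block_separated vx.
have vA : v \in A by rewrite inE connect0.
have flowF c : (\sum_(x in A) inflow (restrict F c) x = inflow (restrict F c) v)%N /\
    (\sum_(x in A) outflow (restrict F c) x = outflow (restrict F c) v)%N.
  rewrite !(bigD1 v vA) /= !big1 ?addn0 // => x /andP[xA xv];
  by have [] := notB c x (onlyv x xA xv).
(* An arc outside [F] has both ends in [A] or neither, so it contributes equally to total inflow and
   total outflow. *)
have flowK c : expo_supp (arcs o) c ->
    (\sum_(x in A) inflow (restrict (~: F) c) x =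
     \sum_(x in A) outflow (restrict (~: F) c) x)%N.
  move=> co; rewrite sum_inflow sum_outflow [LHS]big_mkcond [RHS]big_mkcond.
  apply: eq_bigr => p _; rewrite ffunE.
  have [|_] := boolP (p \in ~: F); last by rewrite !if_same.
  have [po|/co->] := boolP (p \in arcs o); last by rewrite !if_same.
  rewrite !inE; move: po; rewrite inE => po; rewrite po /= => pB.
  have ep : e p.1 p.2 by rewrite /e /= oadj po.
  by rewrite -(same_connect_r e_sym (connect1 ep)).
have inE' c : (\sum_(x in A) inflow c x =
    inflow (restrict F c) v + \sum_(x in A) inflow (restrict (~: F) c) x)%N.
  rewrite -(proj1 (flowF c)) -big_split /=; apply: eq_bigr => x _.
  by rewrite -inflowD -restrict_split.
have outE' c : (\sum_(x in A) outflow c x =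
    outflow (restrict F c) v + \sum_(x in A) outflow (restrict (~: F) c) x)%N.
  rewrite -(proj2 (flowF c)) -big_split /=; apply: eq_bigr => x _.
  by rewrite -outflowD -restrict_split.
have : (\sum_(x in A) (inflow a x + outflow b x) =
        \sum_(x in A) (inflow b x + outflow a x))%N.
  by apply: eq_bigr => x _; exact: ab.
rewrite !big_split /= (inE' a) (inE' b) (outE' a) (outE' b) (flowK a ao) (flowK b bo).
lia.
Qed.

Lemma splits_subset (E E' F : {set G * G}) :
  E' \subset E -> splits E F -> splits E' F.
Proof. by move=> EE' spl a b aE bE; apply: spl; exact: expo_supp_subset EE' _. Qed.

End Blocks.

(** * Gluing blocks and restricting to a block *)

Section Transfer.

Variables (k : fieldType) (G : sgraph).
Implicit Types (B : subgraph G) (o : rel G).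

Let incl B (x : B) : G := val x.

Let incl_inj B : injective (@incl B).
Proof. exact: val_inj. Qed.

Lemma pair_map_id (A : {set G * G}) : pair_map id @: A = A.
Proof.
apply/setP=> p; apply/imsetP/idP => [[q qA ->]|pA]; first by case: q qA.
by exists p => //; case: p pA.
Qed.

(** Blocks are glued one at a time with [complete_intersectionU] until every arc, each lying in some
    block, is covered. *)
Lemma CIO_of_blocks :
  (forall B, is_block B -> CIO k B) -> CIO k G.
Proof.
move=> blocksCI o oG; have [oadj oanti] := oG.
apply/(bci_complete_intersection k oG (f := id)) => //; rewrite pair_map_id.
have blockCI B : is_block B -> complete_intersection (block_arcs B o).
  move=> bB; pose oB : rel B := [rel x y | o (val x) (val y) && sadj B (val x) (val y)].
  have oBP : orientation oB.
    split=> x y.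
      have /= := @sadj_sub _ B (val x) (val y); have := oadj (val x) (val y).
      rewrite /oB /= [sadj B (val y) _]sadj_sym -andb_orl /sub_adj /=.
      by case: (sadj B _ _) => [<- /(_ isT)/and3P[_ _ ->]//|]; rewrite ?andbF.
    by apply: contraNN (oanti (val x) (val y)) => /andP[/andP[-> _] /andP[-> _]].
  have := blocksCI B bB oB oBP.
  rewrite (bci_complete_intersection k oBP (f := @incl B)); last exact: incl_inj.
  suff -> : pair_map (@incl B) @: arcs oB = block_arcs B o by [].
  apply/setP=> -[x y]; apply/imsetP/idP => [[[x' y']]|]; rewrite !inE /=.
    by move=> oxy [-> ->].
  move=> /andP[oxy Bxy]; have /andP[xB yB] := sadj_verts Bxy.
  by exists (Sub x xB, Sub y yB); rewrite ?inE /oB /= ?oxy.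
(* The induction also records that each block lies inside [E] or is disjoint from it; a block with
   an arc not yet covered is therefore disjoint from [E]. *)
suff [E [Eo EA _ ciE]] : exists E : {set G * G}, [/\ E \subset arcs o,
    {subset enum (arcs o) <= E},
    forall B, is_block B -> (block_arcs B o \subset E) || [disjoint block_arcs B o & E]
    & complete_intersection E].
  suff -> : arcs o = E by [].
  apply/eqP; rewrite eqEsubset Eo andbT; apply/subsetP => p pA.
  by apply: EA; rewrite mem_enum.
have : {subset enum (arcs o) <= arcs o} by move=> p; rewrite mem_enum.
elim: (enum _) => [|p l IHl] lA.
  exists set0; split=> //; [exact: sub0set| |exact: complete_intersection0].
  by move=> B _; rewrite disjoint_sym -setI_eq0 set0I eqxx orbT.
have [q ql|E [Eo lE sepE ciE]] := IHl; first by apply: lA; rewrite inE ql orbT.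
have [pE|pE] := boolP (p \in E).
  by exists E; split=> // q; rewrite inE => /orP[/eqP->|/lE].
have po : p \in arcs o by apply: lA; rewrite mem_head.
have [B bB Bp] : exists2 B, is_block B & sadj B p.1 p.2.
  by apply: edge_in_block; move: po; rewrite inE oadj => ->.
have pF : p \in block_arcs B o by rewrite inE po.
have /orP[/subsetP/(_ p pF)|disE] := sepE B bB; first by rewrite (negPf pE).
exists (block_arcs B o :|: E); split.
- by rewrite subUset block_arcs_sub.
- move=> q; rewrite inE => /orP[/eqP->|/lE qE]; first by rewrite inE pF.
  by rewrite inE qE orbT.
- move=> C bC.
  have [dis|ndis] := boolP [disjoint block_arcs C o & block_arcs B o].
    have /orP[sub|dis'] := sepE C bC; apply/orP; [left|right].
      by rewrite (subset_trans sub) ?subsetUr.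
    by rewrite -setI_eq0 setIUr setU_eq0 !setI_eq0 dis dis'.
  move: ndis; rewrite -setI_eq0 => /set0Pn[q].
  rewrite !inE => /andP[/andP[_ Cq] /andP[_ Bq]].
  (* A block [C] sharing an arc with [B] is contained in [B], hence its arcs are already covered. *)
  have [_ leCB] := block_shared_edge bB (proj1 bC) Bq Cq.
  apply/orP; left; apply: (subset_trans _ (subsetUl _ _)).
  by apply/subsetP => r; rewrite !inE => /andP[-> /leCB].
- apply: complete_intersectionU => //; last exact: blockCI.
  apply: splits_subset (block_splits oG bB).
  by rewrite subUset block_arcs_sub.
Qed.

(** A given orientation of [B] is extended to [G] by directing the other edges along [enum_rank],
    which then serves as the potential for [complete_intersection_restrict]. *)
Lemma CIO_block B : CIO k G -> is_block B -> CIO k B.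
Proof.
move=> ciG bB oB [oBadj oBanti].
(* The existential form extends [oB] from the subtype to all of [G], with value false off [B]. *)
pose lift x y := [exists a : B, exists b : B, [&& val a == x, val b == y & oB a b]].
have liftE (a b : B) : lift (val a) (val b) = oB a b.
  apply/existsP/idP => [[a' /existsP[b' /and3P[/eqP/val_inj-> /eqP/val_inj->]]]//|ab].
  by exists a; apply/existsP; exists b; rewrite !eqxx.
pose o : rel G := fun x y =>
  adj G x y && if sadj B x y then lift x y else (enum_rank x < enum_rank y)%N.
have adjB (a b : B) : sadj B (val a) (val b) = oB a b || oB b a.
  exact: (oBadj a b).
have oG : orientation o.
  split=> x y; rewrite /o (adj_sym y x) (sadj_sym B y x).
    case: (boolP (adj G x y)) => //= xy.
    case: (boolP (sadj B x y)) => [Bxy|_].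
      have /andP[xB yB] := sadj_verts Bxy.
      by have := adjB (Sub x xB) (Sub y yB); rewrite -!liftE /= Bxy.
    rewrite -neq_ltn; apply/esym; apply: contraTneq xy => /val_inj/enum_rank_inj->.
    by rewrite adj_irr.
  case: (boolP (adj G x y)) => //= xy.
  case: (boolP (sadj B x y)) => [Bxy|_]; last by lia.
  have /andP[xB yB] := sadj_verts Bxy.
  by have := oBanti (Sub x xB) (Sub y yB); rewrite -!liftE.
have oBP : orientation oB by [].
apply/(bci_complete_intersection k oBP (f := @incl B)); first exact: incl_inj.
have -> : pair_map (@incl B) @: arcs oB = block_arcs B o.
  apply/setP=> -[x y]; apply/imsetP/idP => [[[a b]]|]; rewrite !inE /=.
    move=> oab [-> ->]; rewrite /o liftE oab.
    have Bab : sadj B (val a) (val b) by rewrite adjB oab.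
    by have /and3P[_ _ ->] := sadj_sub Bab; rewrite Bab.
  rewrite /o => /andP[/andP[_ oxy] Bxy]; move: oxy; rewrite Bxy => oxy.
  have /andP[xB yB] := sadj_verts Bxy.
  by exists (Sub x xB, Sub y yB) => //; rewrite inE /= -liftE.
have := ciG o oG.
rewrite (bci_complete_intersection k oG (f := id)) // pair_map_id.
apply: (complete_intersection_restrict (w := fun x => enum_rank x)).
- move=> [x y]; rewrite !inE /= => oxy; rewrite oxy /= => /negPf nB.
  by move: oxy; rewrite /o nB => /andP[].
- exact: block_splits.
- exact: block_arcs_sub.
Qed.

End Transfer.

Theorem proposition3p11 (k : fieldType) (G : sgraph) :
  CIO k G <-> (forall B : subgraph G, is_block B -> CIO k B).
Proof. by split=> [ciG B|]; [exact: CIO_block|exact: CIO_of_blocks]. Qed.
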